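(* Let $\lambda,\mu,\theta,\Delta>0$, $\rho:=\lambda/\mu$, and let $N\ge 3$ be an odd integer. Put $$a:=e^{-\mu\Delta},\qquad b:=\rho\left(1-e^{-\mu\Delta}\right),$$ and define $g:\mathbb{R}\to\mathbb{R}$ by $$g(x):=\frac{e^{-\theta x}}{\left(\frac{N+1}{2}\right)e^{-\theta x}+\left(\frac{N-1}{2}\right)e^{-\frac{2\rho\theta}{N-1}}e^{\theta\left(\frac{N+1}{N-1}\right)x}} .$$ Then the linear approximations of the amplitudes (defined in the context) are $$A_1^{(1)}=\frac{(a-1)L_1^{(1)}+b\, g\left(L_1^{(1)}\right)}{2}$$ for the set of $\frac{N+1}{2}$ queues, and $$A_2^{(1)}=\left(\frac{N+1}{N-1}\right)A_1^{(1)}$$ for the remaining $\frac{N-1}{2}$ queues, where $$L_1^{(1)}=\frac{ab\, g(0)+b\, g(b\, g(0))}{1-a^2-ab\, g'(0)-g'(b\, g(0))\left(ab+b^2 g'(0)\right)} .$$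
   Context: Consider the $N$-queue updating system $\dot q_i(t)=\lambda\,\frac{\exp(-\theta q_i(\Phi(t,\Delta)))}{\sum_{j=1}^N\exp(-\theta q_j(\Phi(t,\Delta)))}-\mu q_i(t)$, $i=1,\dots,N$, with $\Phi(t,\Delta)=\lfloor t/\Delta\rfloor\Delta$. For odd $N$ the steady-state oscillation considered is one in which $\frac{N+1}{2}$ queues coincide, with lower and upper values $L_1,U_1$, and the remaining $\frac{N-1}{2}$ queues coincide, with lower and upper values $L_2,U_2$; these values are taken to satisfy $$U_1=aL_1+b\,g(L_1),\qquad L_1=aU_1+b\,g(U_1),$$ $$\tfrac{N+1}{2}U_1+\tfrac{N-1}{2}L_2=\rho,\qquad \tfrac{N+1}{2}L_1+\tfrac{N-1}{2}U_2=\rho,$$ and the two amplitudes are $\frac{U_1-L_1}{2}$ and $\frac{U_2-L_2}{2}$ (here $a,b,g$ are as in the claim). The linear approximations are defined as follows. Substituting the first equation into the second gives $L_1=a^2L_1+ab\,g(L_1)+b\,g(aL_1+b\,g(L_1))$. Then $L_1^{(1)}$ is the solution of the linear equation obtained by replacing the functions $x\mapsto g(x)$ and $x\mapsto g(ax+b\,g(x))$ in the right-hand side by their first-order Taylor polynomials at $x=0$, that is, of $$x=a^2x+ab\left[g(0)+g'(0)x\right]+b\left[g(b\,g(0))+g'(b\,g(0))\,(a+b\,g'(0))\,x\right].$$ Further, $U_1^{(1)}:=aL_1^{(1)}+b\,g(L_1^{(1)})$, and $L_2^{(1)},U_2^{(1)}$ are defined by $\tfrac{N+1}{2}U_1^{(1)}+\tfrac{N-1}{2}L_2^{(1)}=\rho$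 and $\tfrac{N+1}{2}L_1^{(1)}+\tfrac{N-1}{2}U_2^{(1)}=\rho$. The linear approximations of the amplitudes are $A_1^{(1)}=\frac{U_1^{(1)}-L_1^{(1)}}{2}$ and $A_2^{(1)}=\frac{U_2^{(1)}-L_2^{(1)}}{2}$. *)

(* Defs.v *)
From Stdlib Require Import Reals Arith.
From Coquelicot Require Import Coquelicot.
Open Scope R_scope.

Definition g_fun (rho theta : R) (N : nat) (x : R) : R :=
  exp (- theta * x) /
  ((INR N + 1) / 2 * exp (- theta * x)
   + (INR N - 1) / 2 * exp (- (2 * rho * theta / (INR N - 1)))
     * exp (theta * ((INR N + 1) / (INR N - 1)) * x)).

Definition taylor1 (f : R -> R) (x : R) : R := f 0 + Derive f 0 * x.

(* Eliminating U1 from U1 = a L1 + b g(L1) and L1 = a U1 + b g(U1) gives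
   L1 = a^2 L1 + a b g(L1) + b g(a L1 + b g(L1)), that is,
   L1 = fixpoint_rhs a b g (fun x => g (a * x + b * g x)) L1. *)
Definition fixpoint_rhs (a b : R) (f h : R -> R) (x : R) : R :=
  a ^ 2 * x + a * b * f x + b * h x.

Definition linearized_rhs (a b : R) (g : R -> R) : R -> R :=
  fixpoint_rhs a b (taylor1 g) (taylor1 (fun x => g (a * x + b * g x))).

(* L1, U1, L2, U2 are the linear approximations of the lower and upper values
   of the (N+1)/2 queues (index 1) and of the (N-1)/2 queues (index 2). *)
Record linear_approximations (rho a b : R) (g : R -> R) (N : nat)
    (L1 U1 L2 U2 : R) : Prop := {
  linapprox_L1 : unique (fun x => x = linearized_rhs a b g x) L1;
  linapprox_U1 : U1 = a * L1 + b * g L1;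
  linapprox_L2 : (INR N + 1) / 2 * U1 + (INR N - 1) / 2 * L2 = rho;
  linapprox_U2 : (INR N + 1) / 2 * L1 + (INR N - 1) / 2 * U2 = rho
}.

Definition amplitude (L U : R) : R := (U - L) / 2.

(* Main.v *)
Require Import Defs.
From Stdlib Require Import Reals Arith Lra Lia.
From Coquelicot Require Import Coquelicot.
Open Scope R_scope.

(** Write [p] and [q] for the slopes of [g] at [0] and at [b * g 0].  By the
    chain rule, the linearized equation reads
    [x = a b g(0) + b g(b g(0)) + (a + b p) (a + b q) x], so the announced
    formula for [L1] is its only solution as soon as [(a + b p) (a + b q)] is
    not [1]; the statements about the amplitudes are then linear algebra.

    The substance is therefore the inequality [(a + b p) (a + b q) < 1].
    Dividing by the exponential in its numerator turns [g] into the decreasing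
    logistic curve [1 / (M + K exp (alpha x - s))], with [M = (N+1)/2],
    [K = (N-1)/2], [s = 2 rho theta / (N-1)] and [rho alpha = N s].  Both
    factors [a + b p] and [a + b q] are smaller than [1], so the product can
    reach [1] only if both are negative, and then it is at most [rho^2 p q].  In
    the variable [y = exp (alpha x - s)] the slope is
    [- alpha K y / (M + K y)^2].  At [x = 0], where [y = exp (-s)], this gives
    [rho |p| < 2 s exp (-s)]; at every point, the inequality of arithmetic and
    geometric means gives [rho |q| <= s / 2].  Hence
    [rho^2 p q < s^2 exp (-s) <= 1] ([slope_product_lt_1]).  The slope at [b g(0)]
    can be arbitrarily large; the exponential smallness of the slope at [0]
    compensates for it. *)

(** * The logistic form of g *)

(** For [n = INR N], the rate [logistic_rate theta n] is the sum of the two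
    exponents [theta] and [theta * (n + 1) / (n - 1)] met when the fraction
    defining [g] is divided by its numerator. *)
Definition logistic_rate (theta n : R) : R := 2 * n * theta / (n - 1).

Definition logistic_shift (rho theta n : R) : R := 2 * rho * theta / (n - 1).

Definition logistic_odds (rho theta n x : R) : R :=
  exp (logistic_rate theta n * x - logistic_shift rho theta n).

Definition g_slope (rho theta n x : R) : R :=
  - (logistic_rate theta n * ((n - 1) / 2) * logistic_odds rho theta n x
     / ((n + 1) / 2 + (n - 1) / 2 * logistic_odds rho theta n x) ^ 2).

Lemma g_fun_logistic (rho theta : R) (N : nat) (x : R) :
  1 < INR N ->
  g_fun rho theta N x
  = / ((INR N + 1) / 2 + (INR N - 1) / 2 * logistic_odds rho theta (INR N) x).
Proof.
  intros hn; unfold g_fun, logistic_odds.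
  assert (Hodds : exp (- (2 * rho * theta / (INR N - 1)))
                  * exp (theta * ((INR N + 1) / (INR N - 1)) * x)
                  = exp (- theta * x)
                    * exp (logistic_rate theta (INR N) * x
                           - logistic_shift rho theta (INR N))).
  { rewrite <- !exp_plus; f_equal.
    unfold logistic_rate, logistic_shift; field; lra. }
  rewrite Rmult_assoc, Hodds.
  pose proof (exp_pos (- theta * x)) as HE.
  set (y := exp (logistic_rate theta (INR N) * x
                 - logistic_shift rho theta (INR N))).
  assert (Hy : 0 < y) by apply exp_pos.
  assert (0 < (INR N - 1) * y) by (apply Rmult_lt_0_compat; lra).
  field; split; [lra|].
  assert (0 < exp (- theta * x) * (INR N + 1 + (INR N - 1) * y))
    by (apply Rmult_lt_0_compat; lra).
  lra.
Qed.

Lemma is_derive_g_fun (rho theta : R) (N : nat) (x : R) :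
  1 < INR N -> is_derive (g_fun rho theta N) x (g_slope rho theta (INR N) x).
Proof.
  intros hn.
  apply is_derive_ext with
    (fun t => / ((INR N + 1) / 2
                 + (INR N - 1) / 2 * logistic_odds rho theta (INR N) t)).
  { intros t; symmetry; now apply g_fun_logistic. }
  unfold g_slope, logistic_odds.
  pose proof (exp_pos (logistic_rate theta (INR N) * x
                       - logistic_shift rho theta (INR N))) as Hy.
  assert (0 < (INR N - 1) * exp (logistic_rate theta (INR N) * x
                                 - logistic_shift rho theta (INR N)))
    by (apply Rmult_lt_0_compat; lra).
  auto_derive.
  - unfold Rminus in *; lra.
  - unfold Rminus in *; field; lra.
Qed.

(** * Bounds on the slopes *)

Lemma logistic_odds_pos (rho theta n x : R) : 0 < logistic_odds rho theta n x.
Proof. apply exp_pos. Qed.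

Lemma g_slope_neg (rho theta n x : R) :
  0 < theta -> 1 < n -> g_slope rho theta n x < 0.
Proof.
  intros hth hn; unfold g_slope.
  pose proof (logistic_odds_pos rho theta n x) as Hy.
  assert (0 < logistic_rate theta n)
    by (unfold logistic_rate; apply Rdiv_lt_0_compat; nra).
  assert (0 < (n - 1) / 2 * logistic_odds rho theta n x)
    by (apply Rmult_lt_0_compat; lra).
  apply Ropp_lt_gt_0_contravar, Rdiv_lt_0_compat.
  - rewrite Rmult_assoc; now apply Rmult_lt_0_compat.
  - apply pow_lt; lra.
Qed.

(** Multiplying a slope by [rho] removes every parameter except [n] and the
    shift [s], because [rho] times the rate is [n s]. *)
Lemma rho_g_slope (rho theta n x : R) :
  1 < n ->
  rho * - g_slope rho theta n x
  = n * logistic_shift rho theta n * ((n - 1) / 2) * logistic_odds rho theta n x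
    / ((n + 1) / 2 + (n - 1) / 2 * logistic_odds rho theta n x) ^ 2.
Proof.
  intros hn; unfold g_slope, logistic_rate, logistic_shift.
  pose proof (logistic_odds_pos rho theta n x) as Hy.
  assert (0 < (n - 1) * logistic_odds rho theta n x)
    by (apply Rmult_lt_0_compat; lra).
  field; split; lra.
Qed.

(** By the inequality of arithmetic and geometric means,
    [K y / (M + K y)^2 <= 1 / (4 M)], and [n < 2 M]. *)
Lemma rho_g_slope_le (rho theta n x : R) :
  0 < rho -> 0 < theta -> 1 < n ->
  rho * - g_slope rho theta n x <= logistic_shift rho theta n / 2.
Proof.
  intros hr hth hn; rewrite rho_g_slope by assumption.
  assert (Hs : 0 < logistic_shift rho theta n)
    by (unfold logistic_shift; apply Rdiv_lt_0_compat; nra).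
  set (s := logistic_shift rho theta n) in *.
  pose proof (logistic_odds_pos rho theta n x) as Hy.
  set (y := logistic_odds rho theta n x) in *.
  set (z := (n - 1) / 2 * y).
  assert (Hz : 0 < z) by (apply Rmult_lt_0_compat; lra).
  apply Rle_div_l; [apply pow_lt; lra|].
  replace (n * s * ((n - 1) / 2) * y) with (s * (n * z))
    by (unfold z; ring).
  replace (s / 2 * ((n + 1) / 2 + z) ^ 2)
    with (s * (((n + 1) / 2 + z) ^ 2 / 2)) by field.
  apply Rmult_le_compat_l; [lra|].
  pose proof (pow2_ge_0 ((n + 1) / 2 - z)); nra.
Qed.

(** Dropping [K y] from the denominator leaves [n K / M^2 < 2]; the odds at
    [0] are [exp (- s)]. *)
Lemma rho_g_slope_0_lt (rho theta n : R) :
  0 < rho -> 0 < theta -> 1 < n ->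
  rho * - g_slope rho theta n 0
  < 2 * logistic_shift rho theta n * exp (- logistic_shift rho theta n).
Proof.
  intros hr hth hn; rewrite rho_g_slope by assumption.
  assert (Hs : 0 < logistic_shift rho theta n)
    by (unfold logistic_shift; apply Rdiv_lt_0_compat; nra).
  replace (logistic_odds rho theta n 0)
    with (exp (- logistic_shift rho theta n))
    by (unfold logistic_odds; f_equal; ring).
  set (s := logistic_shift rho theta n) in *.
  pose proof (exp_pos (- s)) as Hy; set (y := exp (- s)) in *.
  set (z := (n - 1) / 2 * y).
  assert (Hz : 0 < z) by (apply Rmult_lt_0_compat; lra).
  apply Rlt_div_l; [apply pow_lt; lra|].
  replace (n * s * ((n - 1) / 2) * y) with (s * y * (n * ((n - 1) / 2)))
    by ring.
  replace (2 * s * y * ((n + 1) / 2 + z) ^ 2)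
    with (s * y * (2 * ((n + 1) / 2 + z) ^ 2)) by ring.
  apply Rmult_lt_compat_l; [now apply Rmult_lt_0_compat | nra].
Qed.

(** Squaring [1 + s/4 <= exp (s/4)] gives [exp (s/2) >= (1 + s/4)^2 >= s];
    squaring once more gives the claim. *)
Lemma sqr_mul_exp_opp_le_1 (s : R) : 0 <= s -> s ^ 2 * exp (- s) <= 1.
Proof.
  intros Hs.
  assert (H4 : 1 + s / 4 <= exp (s / 4)) by apply exp_ineq1_le.
  assert (H2 : s <= exp (s / 4) ^ 2)
    by (pose proof (pow2_ge_0 (1 - s / 4)); nra).
  assert (H1 : s ^ 2 <= exp s).
  { replace (exp s) with ((exp (s / 4) ^ 2) ^ 2)
      by (simpl; rewrite !Rmult_1_r, <- !exp_plus; f_equal; field).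
    apply pow_incr; lra. }
  rewrite exp_Ropp; apply Rle_div_l; [apply exp_pos | lra].
Qed.

(** The first point is [0], where the slope is exponentially small in the shift;
    the second is arbitrary, as the bound on its slope is uniform. *)
Lemma slope_product_lt_1 (rho theta n x : R) :
  0 < rho -> 0 < theta -> 1 < n ->
  (rho * g_slope rho theta n 0) * (rho * g_slope rho theta n x) < 1.
Proof.
  intros hr hth hn.
  assert (Hs : 0 < logistic_shift rho theta n)
    by (unfold logistic_shift; apply Rdiv_lt_0_compat; nra).
  pose proof (rho_g_slope_0_lt rho theta n hr hth hn) as Hp.
  pose proof (rho_g_slope_le rho theta n x hr hth hn) as Hq.
  pose proof (g_slope_neg rho theta n 0 hth hn) as Hp0.
  pose proof (g_slope_neg rho theta n x hth hn) as Hq0.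
  pose proof (sqr_mul_exp_opp_le_1 _ (Rlt_le _ _ Hs)) as Hexp.
  set (s := logistic_shift rho theta n) in *.
  assert (Hq1 : 0 < rho * - g_slope rho theta n x)
    by (apply Rmult_lt_0_compat; lra).
  apply Rlt_le_trans with (2 * s * exp (- s) * (s / 2)); [|lra].
  replace (rho * g_slope rho theta n 0 * (rho * g_slope rho theta n x))
    with (rho * - g_slope rho theta n 0 * (rho * - g_slope rho theta n x))
    by ring.
  apply Rlt_le_trans
    with (2 * s * exp (- s) * (rho * - g_slope rho theta n x)).
  - now apply Rmult_lt_compat_r.
  - apply Rmult_le_compat_l; [|assumption].
    pose proof (exp_pos (- s)); nra.
Qed.

(** Since [b = rho (1 - a)], this applies with [P = rho p] and [Q = rho q].  Each
    factor is a convex combination of [1] and a negative number, hence below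
    [1]; if both are negative, their absolute values are below [|P|] and
    [|Q|]. *)
Lemma convex_product_lt_1 (a P Q : R) :
  0 < a < 1 -> P < 0 -> Q < 0 -> P * Q < 1 ->
  (a + (1 - a) * P) * (a + (1 - a) * Q) < 1.
Proof.
  intros Ha HP HQ HPQ.
  set (u := a + (1 - a) * P); set (v := a + (1 - a) * Q).
  assert (Hu : u < 1) by (unfold u; nra).
  assert (Hv : v < 1) by (unfold v; nra).
  assert (HuP : P < u) by (unfold u; nra).
  assert (HvQ : Q < v) by (unfold v; nra).
  destruct (Rle_lt_dec 0 u), (Rle_lt_dec 0 v); nra.
Qed.

(** * The linearized equation *)

Lemma linearized_rhs_affine (a b p q : R) (g : R -> R) (x : R) :
  is_derive g 0 p -> is_derive g (b * g 0) q ->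
  linearized_rhs a b g x
  = a * b * g 0 + b * g (b * g 0) + (a + b * p) * (a + b * q) * x.
Proof.
  intros Hp Hq.
  assert (Hinner : is_derive (fun t => a * t + b * g t) 0 (a + b * p)).
  { assert (Dp : Derive (fun t => g t) 0 = p) by now apply is_derive_unique.
    auto_derive; [now exists p | rewrite Dp; ring]. }
  assert (Hcomp : is_derive (fun t => g (a * t + b * g t)) 0
                            ((a + b * p) * q)).
  { apply (is_derive_comp g (fun t => a * t + b * g t)); [|assumption].
    now replace (a * 0 + b * g 0) with (b * g 0) by ring. }
  assert (Dcomp : Derive (fun t => g (a * t + b * g t)) 0 = (a + b * p) * q)
    by now apply is_derive_unique.
  unfold linearized_rhs, fixpoint_rhs, taylor1.
  rewrite (is_derive_unique _ _ _ Hp), Dcomp.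
  replace (a * 0 + b * g 0) with (b * g 0) by ring.
  ring.
Qed.

Theorem theorem3p1 (lambda mu theta Delta : R) (N : nat)
  (hlambda : 0 < lambda) (hmu : 0 < mu) (htheta : 0 < theta)
  (hDelta : 0 < Delta) (hN3 : (3 <= N)%nat) (hNodd : Nat.Odd N) :
  let rho := lambda / mu in
  let a := exp (- (mu * Delta)) in
  let b := rho * (1 - exp (- (mu * Delta))) in
  let g := g_fun rho theta N in
  (exists L1 U1 L2 U2 : R, linear_approximations rho a b g N L1 U1 L2 U2) /\
  (forall L1 U1 L2 U2 : R,
    linear_approximations rho a b g N L1 U1 L2 U2 ->
    amplitude L1 U1 = ((a - 1) * L1 + b * g L1) / 2 /\
    amplitude L2 U2 = (INR N + 1) / (INR N - 1) * amplitude L1 U1 /\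
    L1 = (a * b * g 0 + b * g (b * g 0)) /
         (1 - a ^ 2 - a * b * Derive g 0
          - Derive g (b * g 0) * (a * b + b ^ 2 * Derive g 0))).
Proof.
  intros rho a b g.
  assert (hn : 1 < INR N) by (apply (lt_INR 1); lia).
  assert (hrho : 0 < rho) by now apply Rdiv_lt_0_compat.
  assert (ha : 0 < a < 1).
  { split; [apply exp_pos|].
    unfold a; rewrite <- exp_0; apply exp_increasing; nra. }
  pose proof (is_derive_g_fun rho theta N 0 hn) as Hp.
  pose proof (is_derive_g_fun rho theta N (b * g 0) hn) as Hq.
  assert (Hlt : (a + b * g_slope rho theta (INR N) 0)
                * (a + b * g_slope rho theta (INR N) (b * g 0)) < 1).
  { pose proof (g_slope_neg rho theta (INR N) 0 htheta hn).
    pose proof (g_slope_neg rho theta (INR N) (b * g 0) htheta hn).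
    replace (b * g_slope rho theta (INR N) 0)
      with ((1 - a) * (rho * g_slope rho theta (INR N) 0))
      by (unfold b; fold a; ring).
    replace (b * g_slope rho theta (INR N) (b * g 0))
      with ((1 - a) * (rho * g_slope rho theta (INR N) (b * g 0)))
      by (unfold b at 2; fold a; ring).
    apply convex_product_lt_1; [assumption | nra | nra |].
    now apply slope_product_lt_1. }
  fold g in Hp, Hq.
  pose proof (fun x => linearized_rhs_affine a b _ _ g x Hp Hq) as Haff.
  rewrite (is_derive_unique _ _ _ Hp), (is_derive_unique _ _ _ Hq).
  set (p := g_slope rho theta (INR N) 0) in *.
  set (q := g_slope rho theta (INR N) (b * g 0)) in *.
  set (c := a * b * g 0 + b * g (b * g 0)) in *.
  replace (1 - a ^ 2 - a * b * p - q * (a * b + b ^ 2 * p))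
    with (1 - (a + b * p) * (a + b * q)) by ring.
  set (k := (a + b * p) * (a + b * q)) in *.
  assert (Hsol : forall x, x = linearized_rhs a b g x <-> x = c / (1 - k)).
  { intros x; rewrite Haff; split; intros Hx.
    - apply Rmult_eq_reg_r with (1 - k); [field_simplify; lra | lra].
    - rewrite Hx; field; lra. }
  clearbody c k g b a.
  split.
  - exists (c / (1 - k)).
    exists (a * (c / (1 - k)) + b * g (c / (1 - k))).
    exists ((rho - (INR N + 1) / 2
                   * (a * (c / (1 - k)) + b * g (c / (1 - k))))
            / ((INR N - 1) / 2)).
    exists ((rho - (INR N + 1) / 2 * (c / (1 - k))) / ((INR N - 1) / 2)).
    split.
    + split; [now apply Hsol|].
      intros x Hx; symmetry; now apply Hsol.
    + reflexivity.
    + field; lra.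
    + field; lra.
  - intros L1 U1 L2 U2 [[HL1 _] HU1 HL2 HU2]; unfold amplitude.
    repeat split.
    + rewrite HU1; field.
    + apply Rmult_eq_reg_r with (INR N - 1); [|lra].
      replace ((INR N + 1) / (INR N - 1) * ((U1 - L1) / 2) * (INR N - 1))
        with ((INR N + 1) * ((U1 - L1) / 2)) by (field; lra).
      lra.
    + now apply Hsol.
Qed.
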